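(* Let $D_H$ be a weighted oriented graph whose underlying graph $H$ is the $5$-cycle $C_5$. Then $I(D_H)$ is Cohen-Macaulay if and only if either $D_H\simeq D_4$, or there is an edge $(x,y)\in E(D_H)$ with $w(x)=w(y)=1$ and $D_H$ is not isomorphic to any graph of type $D_1$, $D_2$ or $D_3$. Here, writing the cycle as $x_1x_2x_3x_4x_5x_1$ (edges $\{x_1,x_2\},\{x_2,x_3\},\{x_3,x_4\},\{x_4,x_5\},\{x_5,x_1\}$), and with edges not listed as oriented allowed to have either orientation: $D_1$: $(x_4,x_3),(x_4,x_5),(x_3,x_2),(x_5,x_1)\in E$, $w(x_1)=w(x_2)=w(x_4)=1$, $w(x_3)\neq1$, $w(x_5)\ne 1$; $D_2$: $(x_4,x_3),(x_5,x_4),(x_1,x_5)\in E$, $w(x_1)=w(x_2)=w(x_3)=1$, $w(x_4)\ne1$, $w(x_5)\ne1$; $D_3$: $(x_4,x_3),(x_5,x_4),(x_1,x_5)\in E$, $w(x_1)=w(x_2)=1$, $w(x_3)\ne1$, $w(x_4)\ne1$, $w(x_5)\ne1$; $D_4$: $(x_4,x_3),(x_4,x_5),(x_2,x_3),(x_1,x_2)\in E$, $w(x_1)=w(x_4)=1$, $w(x_2)\ne1$, $w(x_3)\ne1$, $w(x_5)\ne1$.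
   Context: A weighted oriented graph $D$ with underlying simple graph on vertices $x_1,\ldots,x_n$ is an orientation of its edges with a weight function $w:V\to\mathbb{Z}_{>0}$; an edge oriented from $x_i$ to $x_j$ is written $(x_i,x_j)$. By convention, a source is assigned weight $1$. The edge ideal is $I(D)=\langle x_ix_j^{w(x_j)}:(x_i,x_j)\in E(D)\rangle\subseteq A=K[x_1,\ldots,x_n]$, $K$ a field; $I(D)$ is Cohen-Macaulay if $A/I(D)$ is Cohen-Macaulay. Isomorphism $\simeq$ of weighted oriented graphs means a graph isomorphism preserving orientations and weights. *)

(* Defs.v *)
From HB Require Import structures.
From mathcomp Require Import all_boot all_order all_algebra all_fingroup.
From mathcomp Require Import mpoly.
Set Implicit Arguments. Unset Strict Implicit. Unset Printing Implicit Defensive.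
Import GRing.Theory.
Local Open Scope ring_scope.

Section CommAlg.
Variables (K : fieldType) (n : nat).
Local Notation A := {mpoly K[n]}.

Definition in_ideal (gs : seq A) (f : A) : Prop :=
  exists cs : seq A, f = \sum_(i < size gs) cs`_i * gs`_i.

Definition in_irrel (f : A) : Prop := mcoeff mnm0 f = 0.

Definition regular_seq (gs fs : seq A) : Prop :=
  (forall k, (k < size fs)%N -> in_irrel fs`_k) /\
  (forall k, (k < size fs)%N -> forall g : A,
      in_ideal (gs ++ take k fs) (fs`_k * g) -> in_ideal (gs ++ take k fs) g) /\
  ~ in_ideal (gs ++ fs) 1.

Definition has_regseq (gs : seq A) (r : nat) : Prop :=
  exists fs : seq A, size fs = r /\ regular_seq gs fs.

Definition depth_is (gs : seq A) (r : nat) : Prop :=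
  has_regseq gs r /\ ~ has_regseq gs r.+1.

Definition is_ideal (P : A -> Prop) : Prop :=
  P 0 /\ (forall a b, P a -> P b -> P (a + b)) /\ (forall a b, P b -> P (a * b)).

Definition is_prime (P : A -> Prop) : Prop :=
  is_ideal P /\ ~ P 1 /\ (forall a b, P (a * b) -> P a \/ P b).

Definition has_prime_chain (gs : seq A) (d : nat) : Prop :=
  exists Ps : nat -> A -> Prop,
    (forall i, (i <= d)%N -> is_prime (Ps i) /\ forall g, g \in gs -> Ps i g) /\
    (forall i, (i < d)%N -> (forall a, Ps i a -> Ps i.+1 a) /\ exists a, Ps i.+1 a /\ ~ Ps i a).

Definition krull_dim_is (gs : seq A) (d : nat) : Prop :=
  has_prime_chain gs d /\ ~ has_prime_chain gs d.+1.

Definition cohen_macaulay (gs : seq A) : Prop :=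
  exists d, krull_dim_is gs d /\ depth_is gs d.

Definition is_source (arc : rel 'I_n) (x : 'I_n) : Prop := forall y, ~~ arc y x.

Definition is_wog (arc : rel 'I_n) (w : 'I_n -> nat) : Prop :=
  (forall x, ~~ arc x x) /\ (forall x y, arc x y -> ~~ arc y x) /\
  (forall x, (0 < w x)%N) /\ (forall x, is_source arc x -> w x = 1%N).

Definition edge_gens (arc : rel 'I_n) (w : 'I_n -> nat) : seq A :=
  [seq 'X_(p.1) * 'X_(p.2) ^+ w p.2 | p <- enum [pred p : 'I_n * 'I_n | arc p.1 p.2]].

Definition wog_iso (arc : rel 'I_n) (w : 'I_n -> nat) (arc' : rel 'I_n) (w' : 'I_n -> nat) : Prop :=
  exists f : {perm 'I_n}, (forall x y, arc' (f x) (f y) = arc x y) /\ (forall x, w' (f x) = w x).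

End CommAlg.

(* the labelled 5-cycle x1 x2 x3 x4 x5 x1, with x_k encoded as index k-1 *)
Definition cyc5 (i j : 'I_5) : bool :=
  (nat_of_ord j == (nat_of_ord i).+1 %% 5)%N || (nat_of_ord i == (nat_of_ord j).+1 %% 5)%N.

Definition underlying_C5 (arc : rel 'I_5) : Prop :=
  exists s : {perm 'I_5}, forall x y, (arc x y || arc y x) = cyc5 (s x) (s y).

Definition x1 : 'I_5 := inord 0.
Definition x2 : 'I_5 := inord 1.
Definition x3 : 'I_5 := inord 2.
Definition x4 : 'I_5 := inord 3.
Definition x5 : 'I_5 := inord 4.

Definition on_labelled_C5 (arc : rel 'I_5) (w : 'I_5 -> nat) : Prop :=
  is_wog arc w /\ forall x y, (arc x y || arc y x) = cyc5 x y.

Definition typeD1 (arc : rel 'I_5) (w : 'I_5 -> nat) : Prop :=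
  on_labelled_C5 arc w /\
  [/\ arc x4 x3, arc x4 x5, arc x3 x2 & arc x5 x1] /\
  [/\ w x1 = 1%N, w x2 = 1%N, w x4 = 1%N, w x3 <> 1%N & w x5 <> 1%N].

Definition typeD2 (arc : rel 'I_5) (w : 'I_5 -> nat) : Prop :=
  on_labelled_C5 arc w /\
  [/\ arc x4 x3, arc x5 x4 & arc x1 x5] /\
  [/\ w x1 = 1%N, w x2 = 1%N, w x3 = 1%N, w x4 <> 1%N & w x5 <> 1%N].

Definition typeD3 (arc : rel 'I_5) (w : 'I_5 -> nat) : Prop :=
  on_labelled_C5 arc w /\
  [/\ arc x4 x3, arc x5 x4 & arc x1 x5] /\
  [/\ w x1 = 1%N, w x2 = 1%N, w x3 <> 1%N, w x4 <> 1%N & w x5 <> 1%N].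

Definition typeD4 (arc : rel 'I_5) (w : 'I_5 -> nat) : Prop :=
  on_labelled_C5 arc w /\
  [/\ arc x4 x3, arc x4 x5, arc x2 x3 & arc x1 x2] /\
  [/\ w x1 = 1%N, w x4 = 1%N, w x2 <> 1%N, w x3 <> 1%N & w x5 <> 1%N].

Definition iso_to_type (T : rel 'I_5 -> ('I_5 -> nat) -> Prop)
    (arc : rel 'I_5) (w : 'I_5 -> nat) : Prop :=
  exists (arc' : rel 'I_5) (w' : 'I_5 -> nat), T arc' w' /\ wog_iso arc w arc' w'.

(* Main.v *)
Require Import Defs.
From mathcomp Require Import all_boot all_order all_algebra all_fingroup.
From mathcomp Require Import mpoly.
From mathcomp Require Import ring zify.

(* All minimal vertex covers of the 5-cycle have three elements, so A/I(D) has
   dimension 2 and is Cohen-Macaulay iff it has a regular sequence of length 2.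
   The dimension bound, for chains of primes and for regular sequences alike,
   comes from counting: any three polynomials are algebraically dependent
   modulo I(D).

   Sufficiency: x1 + x2 + x3, x3 + x4 + x5 restrict to a system of parameters on
   every K[x_k, x_(k+2)], and regularity lifts along 0 -> A/(I : x) -> A/I ->
   A/(I, x) -> 0. Slicing I(D) by the exponent of a well-chosen variable x_j,
   namely 0, between 1 and w(x_j) - 1, or at least w(x_j), reduces to the primes
   of the faces.

   Necessity: for a suitable labelling the monomial x2^(w2-1) ... x5^(w5-1) has
   a degree complex with no edge between {1, 3} and {2, 4, 5}, both parts being
   nonempty, which contradicts depth 2.

   Only the orientations and the set of vertices of weight > 1 matter, so the
   choices of slicing order and of labelling are a finite computation. *)

Set Implicit Arguments. Unset Strict Implicit. Unset Printing Implicit Defensive.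
Import GRing.Theory.
Local Open Scope ring_scope.

(** * Ideals and regular sequences *)

Section Ideals.
Variables (K : fieldType) (n : nat).
Local Notation A := {mpoly K[n]}.
Implicit Types (J : A -> Prop) (f g h : A) (gs : seq A).

Lemma idealD J a b : is_ideal J -> J a -> J b -> J (a + b).
Proof. by case=> _ [JD _]; apply: JD. Qed.

Lemma idealM J a b : is_ideal J -> J b -> J (a * b).
Proof. by case=> _ [_]; apply. Qed.

Lemma idealN J a : is_ideal J -> J a -> J (- a).
Proof. by move=> idJ Ja; rewrite -mulN1r; apply: idealM. Qed.

Lemma idealB J a b : is_ideal J -> J a -> J b -> J (a - b).
Proof. by move=> idJ Ja Jb; apply: idealD => //; apply: idealN. Qed.

Lemma ideal_sum J (I : Type) (r : seq I) (P : pred I) (F : I -> A) :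
  is_ideal J -> (forall i, P i -> J (F i)) -> J (\sum_(i <- r | P i) F i).
Proof.
move=> idJ JF; elim/big_ind: _ => //; first by case: idJ.
by move=> x y; apply: idealD.
Qed.

Lemma in_ideal_is_ideal gs : is_ideal (in_ideal gs).
Proof.
split; first by exists [::]; rewrite big1 // => i _; rewrite nth_nil mul0r.
split=> [a b [c ->] [d ->]|a b [c ->]].
  exists (mkseq (fun i => c`_i + d`_i) (size gs)).
  by rewrite -big_split; apply: eq_bigr => i _; rewrite nth_mkseq // mulrDl.
exists (mkseq (fun i => a * c`_i) (size gs)).
by rewrite big_distrr /=; apply: eq_bigr => i _; rewrite nth_mkseq // mulrA.
Qed.

Lemma mem_in_ideal gs g : g \in gs -> in_ideal gs g.
Proof.
move=> gs_g; exists (mkseq (fun i => (i == index g gs)%:R) (size gs)).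
rewrite (bigD1 (Ordinal (etrans (index_mem g gs) gs_g))) //= big1 => [|i].
  by rewrite nth_mkseq ?index_mem // eqxx mul1r nth_index // addr0.
by rewrite -val_eqE /= nth_mkseq // => /negPf ->; rewrite mul0r.
Qed.

Lemma in_ideal_min gs J h :
  is_ideal J -> (forall g, g \in gs -> J g) -> in_ideal gs h -> J h.
Proof.
move=> idJ Jgs [c ->]; apply: ideal_sum => // i _.
by apply: idealM => //; apply/Jgs/mem_nth.
Qed.

Lemma in_ideal_sub gs gs' h :
  {subset gs <= gs'} -> in_ideal gs h -> in_ideal gs' h.
Proof.
move=> sub; apply: in_ideal_min; first exact: in_ideal_is_ideal.
by move=> g /sub; apply: mem_in_ideal.
Qed.

Definition adjoin J f : A -> Prop := fun h => exists k, J (h - f * k).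

Lemma adjoin_is_ideal J f : is_ideal J -> is_ideal (adjoin J f).
Proof.
move=> idJ; split; first by exists 0; rewrite mulr0 subr0; case: idJ.
split=> [a b [k Jk] [l Jl]|a b [k Jk]].
  exists (k + l); have ->: a + b - f * (k + l) = a - f * k + (b - f * l) by ring.
  exact: idealD.
exists (a * k); have ->: a * b - f * (a * k) = a * (b - f * k) by ring.
exact: idealM.
Qed.

Lemma in_ideal_rcons gs f h : in_ideal (gs ++ [:: f]) h <-> adjoin (in_ideal gs) f h.
Proof.
split.
  apply: in_ideal_min => [|g]; first exact/adjoin_is_ideal/in_ideal_is_ideal.
  rewrite mem_cat mem_seq1 => /orP[/mem_in_ideal gs_g|/eqP->].
    by exists 0; rewrite mulr0 subr0.
  by exists 1; rewrite mulr1 subrr; case: (in_ideal_is_ideal gs).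
case=> k Jk; rewrite -(subrK (f * k) h).
have idJ := in_ideal_is_ideal (gs ++ [:: f]).
apply: idealD => //; first by apply: in_ideal_sub Jk => g; rewrite mem_cat => ->.
by rewrite mulrC; apply: idealM => //; apply: mem_in_ideal; rewrite mem_cat inE eqxx orbT.
Qed.

Lemma in_irrel_is_ideal : is_ideal (@in_irrel K n).
Proof.
rewrite /in_irrel; split; first by rewrite mcoeff0.
split=> a b; first by rewrite mcoeffD => -> ->; rewrite addr0.
by move=> b0; rewrite (rmorphM (mcoeff (0%MM : 'X_{1..n}))) /= b0 mulr0.
Qed.

Lemma in_irrel_prime : is_prime (@in_irrel K n).
Proof.
split; first exact: in_irrel_is_ideal.
rewrite /in_irrel; split=> [/eqP|a b]; first by rewrite mcoeff1 eqxx oner_eq0.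
move/eqP; rewrite (rmorphM (mcoeff (0%MM : 'X_{1..n}))) mulf_eq0.
by case/orP=> /eqP; [left|right].
Qed.

(** Properness of [J + (f, g)] is not demanded: the unit ideal occurs among the slices and has to
    qualify. *)
Definition weakly_regular2 J f g :=
  (forall h, J (f * h) -> J h) /\
  (forall h k, J (g * h - f * k) -> exists k', J (h - f * k')).

Lemma weakly_regular2_ext J J' f g : (forall h, J h <-> J' h) ->
  weakly_regular2 J f g -> weakly_regular2 J' f g.
Proof.
move=> JJ' [H1 H2]; split=> [h /JJ' /H1 /JJ' //|h k /JJ' /H2 [k' /JJ' Hk']].
by exists k'.
Qed.

Lemma has_regseq2P gs : has_regseq gs 2 <->
  exists f g, [/\ in_irrel f, in_irrel g, weakly_regular2 (in_ideal gs) f g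
    & ~ in_ideal (gs ++ [:: f; g]) 1].
Proof.
split=> [[fs [sz [irr [reg nt]]]]|[f [g [f0 g0 [H1 H2] nt]]]].
  case: fs sz irr reg nt => [|f [|g []]] //= _ irr reg nt.
  exists f, g; split=> //; [exact: (irr 0%N)|exact: (irr 1%N)|split].
    by move=> h; move: (reg 0%N isT h); rewrite /= cats0.
  move=> h k Jhk; apply/in_ideal_rcons.
  by apply: (reg 1%N isT h); apply/in_ideal_rcons; exists k.
exists [:: f; g]; split=> //; split; first by case=> [|[|]].
split=> // -[|[|//]] _ h /=; first by rewrite cats0; apply: H1.
by case/in_ideal_rcons=> k /H2 ?; apply/in_ideal_rcons.
Qed.

End Ideals.

(** * Monomial ideals *)

Section MonomialIdeals.
Variables (K : fieldType) (n : nat).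
Local Notation A := {mpoly K[n]}.
Local Notation mon := 'X_{1..n}.
Implicit Types (U V : mon -> bool) (p q h : A) (m k : mon).

(** For an [upset] [U], the monomial ideal with exponent set [U]. Colons by variables and sums with
    them become pointwise operations on [U]. *)
Definition mono U p := forall m, p@_m != 0 -> U m.

Definition upset U := forall m k, U m -> U (m + k)%MM.

Lemma mcoeffM_neq0 p q m : (p * q)@_m != 0 ->
  exists m1 m2, [/\ p@_m1 != 0, q@_m2 != 0 & m = (m1 + m2)%MM].
Proof.
rewrite -mcoeff_msupp => /msuppM_le /allpairsP[[m1 m2] /= []].
by rewrite !mcoeff_msupp => ? ? ->; exists m1, m2.
Qed.

Lemma mono_is_ideal U : upset U -> is_ideal (mono U).
Proof.
move=> upU; split; first by move=> m; rewrite mcoeff0 eqxx.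
split=> [a b Ua Ub m|a b Ub m].
  rewrite mcoeffD; case: (eqVneq (a@_m) 0) => [->|/Ua //].
  by rewrite add0r; apply: Ub.
by case/mcoeffM_neq0=> m1 [m2 [_ /Ub Um2 ->]]; rewrite addmC; apply: upU.
Qed.

Lemma monoX U m : mono U 'X_[m] <-> U m.
Proof.
split=> [/(_ m)|Um k]; rewrite mcoeffX ?eqxx; first by apply; apply: oner_neq0.
by case: (m =P k) => [<-|]; rewrite ?eqxx.
Qed.

Lemma mono_ext U V p : U =1 V -> mono U p <-> mono V p.
Proof. by move=> UV; split=> H m /H; rewrite UV. Qed.

Lemma mono_sub U V p : (forall m, U m -> V m) -> mono U p -> mono V p.
Proof. by move=> UV H m /H /UV. Qed.

Lemma mcoeffXM m p k : ('X_[m] * p)@_(m + k)%MM = p@_k.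
Proof. by rewrite mulrC mcoeffMX. Qed.

Lemma mono_colon U i p :
  mono U ('X_i * p) <-> mono (fun m => U (U_(i) + m)%MM) p.
Proof.
split=> H m; first by rewrite -(mcoeffXM U_(i)); apply: H.
case/mcoeffM_neq0=> m1 [m2 [+ /H ? ->]].
by rewrite mcoeffX; case: (U_(i)%MM =P m1) => [<-|]; rewrite ?eqxx.
Qed.

Lemma mono_split U p : exists p0 p1, [/\ p = p0 + p1, mono U p0,
  mono (fun m => ~~ U m) p1 & forall m, p0@_m != 0 \/ p1@_m != 0 -> p@_m != 0].
Proof.
pose part (V : pred mon) := \sum_(m <- msupp p | V m) p@_m *: 'X_[m] : A.
have partE V m : (part V)@_m = if V m then p@_m else 0.
  rewrite /part raddf_sum /=.
  under eq_bigr do rewrite mcoeffZ mcoeffX.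
  case: (boolP (m \in msupp p)) => [mp|mp].
    case: ifP => Vm; last first.
      rewrite big1 // => k Vk; case: eqP => [km|_]; last by rewrite mulr0.
      by rewrite -km Vk in Vm.
    rewrite -big_filter (bigD1_seq m) ?mem_filter ?Vm ?filter_uniq ?msupp_uniq //=.
    by rewrite eqxx mulr1 big1 ?addr0 // => k /negPf ->; rewrite mulr0.
  rewrite big1_seq; last first.
    move=> k /andP[_ kp]; case: eqP => [km|_]; last by rewrite mulr0.
    by rewrite -km kp in mp.
  by move: mp; rewrite -mcoeff_eq0 => /eqP ->; case: ifP.
exists (part U), (part (fun m => ~~ U m)); split.
- by apply/mpolyP=> m; rewrite mcoeffD !partE; case: (U m); rewrite ?addr0 ?add0r.
- by move=> m; rewrite partE; case: ifP; rewrite ?eqxx.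
- by move=> m; rewrite partE; case: ifP; rewrite ?eqxx.
- by move=> m; rewrite !partE; case: (U m) => /=; rewrite ?eqxx => -[].
Qed.

Lemma mono_div_var i p : mono (fun m => 0 < m i)%N p -> exists q, p = 'X_i * q.
Proof.
move=> Hp; exists (\sum_(m <- msupp p) p@_m *: 'X_[m - U_(i)]).
rewrite big_distrr /= {1}[p]mpolyE; apply: eq_big_seq => m.
rewrite mcoeff_msupp => /Hp mi; rewrite -scalerAr -mpolyXD addmC submK //.
by apply/mnm_lepP=> j; rewrite mnm1E; case: eqP => // <-.
Qed.

Lemma mono_addvar U i p : mono (fun m => U m || (0 < m i)%N) p ->
  exists q, mono U (p - 'X_i * q).
Proof.
move=> Hp; have [p0 [p1 [Ep U0 U1 supp]]] := mono_split U p.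
have /mono_div_var[q Eq] : mono (fun m => 0 < m i)%N p1.
  move=> m p1m; have := Hp m; move=> /(_ (supp m (or_intror p1m))).
  by move: (U1 m p1m) => /negPf ->.
by exists q; rewrite Ep Eq addrK.
Qed.

(** Remove from both factors the terms with exponent in [U]. The product of the remainders still
    lies in the ideal, but by hypothesis none of its exponents is in [U]; so it vanishes, and the
    polynomial ring is a domain. *)
Lemma mono_prime U : upset U -> ~~ U 0%MM ->
  (forall m k, U (m + k)%MM -> U m || U k) -> is_prime (mono U).
Proof.
move=> upU U0 Uprime; have idU := mono_is_ideal upU.
split=> //; split=> [H1|p q Hpq].
  by move: U0; rewrite H1 // mcoeff1 eqxx oner_neq0.
have [p0 [p1 [Ep Up0 Up1 _]]] := mono_split U p.
have [q0 [q1 [Eq Uq0 Uq1 _]]] := mono_split U q.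
have Upq1 : mono U (p1 * q1).
  have ->: p1 * q1 = p * q - q * p0 - p1 * q0 by rewrite Ep Eq; ring.
  by apply: idealB (idealM p1 idU Uq0); rewrite //; apply: idealB (idealM q idU Up0).
have : p1 * q1 == 0.
  apply/eqP/mpolyP=> m; rewrite mcoeff0; apply/eqP; apply: contraT => nz.
  have Um := Upq1 m nz; case/mcoeffM_neq0: nz Um => m1 [m2 [/Up1 n1 /Uq1 n2 ->]].
  by move/Uprime; rewrite (negPf n1) (negPf n2).
rewrite mulf_eq0 => /orP[] /eqP E0; [left; rewrite Ep|right; rewrite Eq].
  by rewrite E0 addr0.
by rewrite E0 addr0.
Qed.

End MonomialIdeals.

(** * Dimension *)

Section Dimension.
Variables (K : fieldType) (n : nat).
Local Notation A := {mpoly K[n]}.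
Implicit Types (J : A -> Prop) (gs : seq A) (U : 'X_{1..n} -> bool).

(** The term [p 0] lies in [J'] because [a] does, so its data vanish; regularity of [a] then divides
    the rest by [a]. The predicate [Z] stands for vanishing of the scalars behind [p k], which lets
    the step be nested. *)
Lemma regular_step J J' (a : A) N (p : nat -> A) (Z : nat -> Prop) :
    is_ideal J -> is_ideal J' -> (forall h, J h -> J' h) -> J' a ->
    (forall h, J (a * h) -> J h) ->
    (forall k, (k < N)%N -> Z k -> p k = 0) ->
    (forall k, (k < N)%N -> J' (p k) -> Z k) ->
  J (\sum_(k < N) p k * a ^+ k) -> forall k, (k < N)%N -> Z k.
Proof.
move=> idJ idJ' JJ' J'a reg; elim: N p Z => [//|N IH] p Z Zp pZ.
rewrite big_ord_recl expr0 mulr1 /=.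
have ->: \sum_(i < N) p (bump 0 i) * a ^+ bump 0 i =
         a * \sum_(i < N) p i.+1 * a ^+ i.
  by rewrite big_distrr; apply: eq_bigr => i _ /=; rewrite exprS; ring.
set q := \sum_(i < N) _ => Jpq.
have Z0 : Z 0%N.
  apply: pZ => //; rewrite -(addrK (a * q) (p 0%N)).
  by apply: idealB => //; [apply: JJ'|rewrite mulrC; apply: idealM].
case=> [//|k]; rewrite ltnS => ltkN; apply: (IH (p \o S) (Z \o S)) ltkN => [i iN|i iN|].
- exact: Zp.
- exact: pZ.
- by apply: reg; move: Jpq; rewrite Zp // add0r.
Qed.

(* Chains of primes and regular sequences both provide such ladders [J], [a]. *)
Lemma regular_ladder_independent (J : nat -> A -> Prop) (a : nat -> A) N
    (c : nat -> nat -> nat -> K) :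
    (forall i, (i <= 3)%N -> is_ideal (J i)) -> ~ J 3%N 1 ->
    (forall i, (i < 3)%N -> [/\ forall h, J i h -> J i.+1 h, J i.+1 (a i)
       & forall h, J i (a i * h) -> J i h]) ->
    J 0%N (\sum_(i < N) (\sum_(j < N) (\sum_(k < N)
       (c i j k)%:MP * a 2%N ^+ k) * a 1%N ^+ j) * a 0%N ^+ i) ->
  forall i j k, (i < N)%N -> (j < N)%N -> (k < N)%N -> c i j k = 0.
Proof.
move=> idJ J1 step J0.
have [s0 b0 r0] := step 0%N isT; have [s1 b1 r1] := step 1%N isT.
have [s2 b2 r2] := step 2%N isT.
pose q i j := \sum_(k < N) (c i j k)%:MP * a 2%N ^+ k.
suff H : forall i, (i < N)%N -> forall j, (j < N)%N -> forall k, (k < N)%N -> c i j k = 0.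
  by move=> i j k iN jN kN; apply: H.
pose Z1 i := forall j, (j < N)%N -> forall k, (k < N)%N -> c i j k = 0.
have q0 i j : (forall k, (k < N)%N -> c i j k = 0) -> q i j = 0.
  by move=> c0; rewrite /q big1 // => k _; rewrite c0 // mpolyC0 mul0r.
apply: (regular_step (idJ 0%N isT) (idJ 1%N isT) s0 b0 r0 (Z := Z1)
  (p := fun i => \sum_(j < N) q i j * a 1%N ^+ j)) J0 => i iN.
  move=> c0; rewrite big1 // => j _.
  by rewrite q0 ?mul0r // => k kN; apply: c0.
pose Z2 j := forall k, (k < N)%N -> c i j k = 0.
move=> J1q; apply: (regular_step (idJ 1%N isT) (idJ 2%N isT) s1 b1 r1 (Z := Z2)
  (p := q i)) J1q => j jN.
  by move/q0.
move=> J2q; apply: (regular_step (idJ 2%N isT) (idJ 3%N isT) s2 b2 r2 (Z := fun k => c i j k = 0)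
  (p := fun k => (c i j k)%:MP)) J2q => k kN.
  by move=> ->; rewrite mpolyC0.
move=> J3; apply/eqP; apply: contra_notT J1 => c0.
rewrite -[1]/(1%:MP : A) -(mulVf c0) mpolyCM.
by apply: idealM; first exact: idJ.
Qed.

Definition deg_le d (p : A) := forall m, p@_m != 0 -> (mdeg m <= d)%N.

Lemma deg_leM d e p q : deg_le d p -> deg_le e q -> deg_le (d + e) (p * q).
Proof.
by move=> dp eq m /mcoeffM_neq0[m1 [m2 [/dp ? /eq ? ->]]]; rewrite mdegD leq_add.
Qed.

Lemma deg_leX d p k : deg_le d p -> deg_le (k * d) (p ^+ k).
Proof.
move=> dp; elim: k => [|k IH]; last by rewrite exprS mulSn; apply: deg_leM.
by move=> m; rewrite expr0 mcoeff1; case: (m =P 0%MM) => [->|]; rewrite ?mdeg0 ?eqxx.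
Qed.

Lemma deg_le_msize p : deg_le (msize p) p.
Proof. by move=> m; rewrite -mcoeff_msupp => /msize_mdeg_lt /ltnW. Qed.

Lemma deg_le_widen d e p : (d <= e)%N -> deg_le d p -> deg_le e p.
Proof. by move=> de dp m /dp /leq_trans; apply. Qed.

(* The [N ^ 3] products of powers live in the span of at most
   [n ^ 2 * (3 * D * N + 1) ^ 2 * W.+1 ^ n] standard monomials, up to [mono U]. *)
Lemma three_dependent U W (a : nat -> A) :
    (forall m : 'X_{1..n}, ~~ U m ->
       exists x y, forall z, z != x -> z != y -> (m z < W)%N) ->
  exists N (c : nat -> nat -> nat -> K),
    (exists i j k, [/\ (i < N)%N, (j < N)%N, (k < N)%N & c i j k != 0]) /\
    mono U (\sum_(i < N) (\sum_(j < N) (\sum_(k < N)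
       (c i j k)%:MP * a 2%N ^+ k) * a 1%N ^+ j) * a 0%N ^+ i).
Proof.
move=> small.
pose D := (msize (a 0%N) + msize (a 1%N) + msize (a 2%N))%N.
(* As [B <= (3 * D + 1) * N], the set [T] has at most [(N - 1) * N ^ 2] elements, fewer than the
   [N ^ 3] of [E]. *)
pose N := ((n ^ 2 * W.+1 ^ n) * (3 * D + 1) ^ 2).+1.
pose B := (3 * D * N).+1.
pose T := ('I_n * 'I_n * ('I_B * 'I_B) * {ffun 'I_n -> 'I_W.+1})%type.
pose E := ('I_N * 'I_N * 'I_N)%type.
(* Two coordinates are below [B], the others at most [W]. Distinct [t] may give the same exponent;
   it suffices to reach every small exponent outside [U]. *)
pose phi (t : T) : 'X_{1..n} := [multinom
  if z == t.1.1.1 then val t.1.2.1 else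
  if z == t.1.1.2 then val t.1.2.2 else val (t.2 z) | z < n].
have phi_onto m : (mdeg m < B)%N -> ~~ U m -> exists t, phi t = m.
  move=> mB /small[x [y mW]].
  have ltB z : (m z < B)%N.
    by apply: leq_ltn_trans mB; rewrite mdegE (bigD1 z) //=; exact: leq_addr.
  exists (x, y, (inord (m x), inord (m y)), [ffun z => inord (m z)]).
  apply/mnmP=> z; rewrite mnmE /= ffunE.
  case: (eqVneq z x) => [->|zx]; first by rewrite inordK.
  case: (eqVneq z y) => [->|zy]; first by rewrite inordK.
  by rewrite inordK // ltnS ltnW // mW.
pose F (e : E) : A := a 2%N ^+ e.2 * a 1%N ^+ e.1.2 * a 0%N ^+ e.1.1.
have degF e : deg_le (3 * D * N) (F e).
  have lt_e (k : 'I_N) i : (i < 3)%N -> (k * msize (a i) <= D * N)%N.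
    move=> i3; rewrite mulnC leq_mul ?(ltnW (ltn_ord k)) //.
    by case: i i3 => [|[|[]]] //= _; rewrite /D; lia.
  have dX i (k : nat) := @deg_leX _ _ k (@deg_le_msize (a i)).
  have := deg_leM (deg_leM (dX 2%N e.2) (dX 1%N e.1.2)) (dX 0%N e.1.1).
  apply: deg_le_widen.
  have := lt_e e.2 2%N isT; have := lt_e e.1.2 1%N isT; have := lt_e e.1.1 0%N isT.
  by lia.
pose M := \matrix_(i < #|{: E}|, j < #|{: T}|) (F (enum_val i))@_(phi (enum_val j)).
have cardET : (#|{: T}| < #|{: E}|)%N.
  rewrite !card_prod card_ffun !card_ord .
  have leB : (B <= (3 * D + 1) * N)%N by rewrite /B mulnDl mul1n -addn1 leq_add2l.
  apply: leq_ltn_trans (_ : n ^ 2 * W.+1 ^ n * (3 * D + 1) ^ 2 * (N * N) < N * N * N)%N.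
    rewrite [X in (_ <= X)%N](_ : _ =
      n * n * (((3 * D + 1) * N) * ((3 * D + 1) * N)) * W.+1 ^ n)%N; last by ring.
    by rewrite leq_mul2r leq_mul2l !leq_mul ?orbT.
  by rewrite -[X in (_ < X)%N]mulnA ltn_mul2r muln_gt0 /N /= ltnS leqnn.
(* With more rows than columns, a nonzero row vector annihilates [M]; its entries are the
   coefficients of the relation. *)
have : kermx M != 0.
  rewrite kermx_eq0 /row_free; apply: contraL cardET => /eqP <-.
  by rewrite -leqNgt rank_leq_col.
case/rowV0Pn=> v /sub_kermxP vM v0.
have [e ve] : exists e, v 0 e != 0.
  apply/existsP; apply: contraR v0; rewrite negb_exists => /forallP v0.
  by apply/eqP/rowP=> e; rewrite mxE; apply/eqP; rewrite -[_ == _]negbK.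
pose oN (i : nat) : 'I_N := inord i.
pose c i j k := v 0 (enum_rank (oN i, oN j, oN k)).
exists N, c; split.
  exists (enum_val e).1.1, (enum_val e).1.2, (enum_val e).2; split=> //.
  by rewrite /c /oN !inord_val -!surjective_pairing enum_valK.
have ->: \sum_(i < N) (\sum_(j < N) (\sum_(k < N)
       (c i j k)%:MP * a 2%N ^+ k) * a 1%N ^+ j) * a 0%N ^+ i =
       \sum_(e < #|{: E}|) (v 0 e)%:MP * F (enum_val e).
  under eq_bigr do rewrite big_distrl /=.
  rewrite pair_bigA; under eq_bigr do rewrite /= big_distrl /= big_distrl /=.
  rewrite pair_bigA (reindex enum_rank) /=; last exact/onW_bij/enum_rank_bij.
  apply: eq_bigr => -[[i j] k] _; rewrite /c /oN !inord_val enum_rankK /F /=; ring.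
move=> m; apply: contraR => Um.
(* Above the degree bound every [F e] has coefficient zero; below it, the coefficient is an entry of
   [v *m M]. *)
case: (leqP B (mdeg m)) => [Bm|mB].
  apply: contraLR Bm => nz; rewrite -ltnNge ltnS.
  move: nz; rewrite raddf_sum /=; apply: contraR => big.
  rewrite big1 // => e' _; rewrite mcoeffCM; apply/eqP; rewrite mulf_eq0.
  by apply/orP; right; apply: contraR big => /degF.
have [t tm] := phi_onto m mB Um.
have /rowP/(_ (enum_rank t)) := vM; rewrite !mxE => vM0; apply/eqP.
rewrite raddf_sum /= -[RHS]vM0; apply: eq_bigr => i _.
by rewrite mcoeffCM !mxE enum_rankK tm.
Qed.

(** The relation found by counting lies in [J 0], whereas the ladder forces all its coefficients to
    vanish. *)
Lemma no_long_ladder U W (J : nat -> A -> Prop) (a : nat -> A) :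
    (forall m : 'X_{1..n}, ~~ U m ->
       exists x y, forall z, z != x -> z != y -> (m z < W)%N) ->
    (forall p, mono U p -> J 0%N p) ->
    (forall i, (i <= 3)%N -> is_ideal (J i)) -> ~ J 3%N 1 ->
    (forall i, (i < 3)%N -> [/\ forall h, J i h -> J i.+1 h, J i.+1 (a i)
       & forall h, J i (a i * h) -> J i h]) -> False.
Proof.
move=> small UJ idJ J1 step.
have [N [c [[i [j [k [iN jN kN /eqP c0]]]] Uc]]] := three_dependent a small.
have J0 := UJ _ Uc; apply: c0.
exact: (regular_ladder_independent idJ J1 step J0).
Qed.

(** A strict chain is a ladder: an element of [P i.+1] outside the prime [P i] is a nonzerodivisor
    modulo [P i]. *)
Lemma no_prime_chain3 U W gs :
    (forall m : 'X_{1..n}, ~~ U m ->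
       exists x y, forall z, z != x -> z != y -> (m z < W)%N) ->
    (forall p, mono U p -> in_ideal gs p) -> ~ has_prime_chain gs 3.
Proof.
move=> small Ugs [P [primeP chainP]].
have idP i : (i <= 3)%N -> is_ideal (P i) by case/primeP=> -[].
have /fin_all_exists[a Pa] : forall i : 'I_3, exists a, P i.+1 a /\ ~ P i a.
  by move=> i; have [_] := chainP i (ltn_ord i).
apply: (no_long_ladder (J := P) (a := fun i => a (inord i)) small).
- move=> p /Ugs; apply: in_ideal_min; first exact: idP.
  by have [] := primeP 0%N isT.
- exact: idP.
- by have [[_ [P1 _]] _] := primeP 3%N isT.
move=> i i3; have [sub _] := chainP i i3.
have [] := Pa (inord i); rewrite inordK // => Pa1 Pa0; split=> // h.
have [[_ [_ Pp]] _] := primeP i (ltnW i3).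
by case/Pp.
Qed.

Lemma no_regseq3 U W gs :
    (forall m : 'X_{1..n}, ~~ U m ->
       exists x y, forall z, z != x -> z != y -> (m z < W)%N) ->
    (forall p, mono U p -> in_ideal gs p) -> ~ has_regseq gs 3.
Proof.
move=> small Ugs [fs [sz [_ [reg nt]]]].
apply: (no_long_ladder (J := fun i => in_ideal (gs ++ take i fs))
  (a := fun i => fs`_i) small).
- by rewrite take0 cats0.
- by move=> i _; apply: in_ideal_is_ideal.
- by rewrite -sz take_size.
move=> i i3; have iN : (i < size fs)%N by rewrite sz.
split; last exact: reg.
  move=> h; apply: in_ideal_sub => g; rewrite (take_nth 0) // -cats1 catA.
  by rewrite [in X in _ -> X]mem_cat => ->.
apply: mem_in_ideal; rewrite (take_nth 0) // mem_cat mem_rcons inE eqxx.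
by rewrite orbT.
Qed.

Lemma prime_chain_leq gs d e : (e <= d)%N -> has_prime_chain gs d -> has_prime_chain gs e.
Proof.
move=> ed [P [primeP chainP]]; exists P; split=> i ie.
  by apply: primeP; apply: leq_trans ie ed.
by apply: chainP; apply: leq_trans ie ed.
Qed.

(** With the chain given, the counting bound makes the dimension exactly 2 and the depth at most 2,
    so only a regular sequence of length 2 is in question. *)
Lemma cohen_macaulay_dim2 U W gs :
    (forall m : 'X_{1..n}, ~~ U m ->
       exists x y, forall z, z != x -> z != y -> (m z < W)%N) ->
    (forall p, mono U p -> in_ideal gs p) -> has_prime_chain gs 2 ->
  cohen_macaulay gs <-> has_regseq gs 2.
Proof.
move=> small Ugs chain2; have no3 := no_prime_chain3 small Ugs.
split=> [[d [[cd cd1] [rd _]]]|reg2]; last first.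
  by exists 2%N; do 2!split=> //; apply: no_regseq3 small Ugs.
suff <-: d = 2%N by [].
apply/eqP; rewrite eqn_leq; apply/andP; split; rewrite leqNgt; apply/negP => lt.
  exact/no3/prime_chain_leq/cd.
exact/cd1/prime_chain_leq/chain2.
Qed.
End Dimension.

(** * Depth *)

Section Depth.
Variables (K : fieldType) (n : nat).
Local Notation A := {mpoly K[n]}.
Local Notation mon := 'X_{1..n}.
Implicit Types (J : A -> Prop) (gs : seq A) (U : mon -> bool) (f g h : A).

Lemma in_irrelP f : in_irrel f -> exists a : 'I_n -> A, f = \sum_i a i * 'X_i.
Proof.
pose J (p : A) := exists a : 'I_n -> A, p = \sum_i a i * 'X_i.
have idJ : is_ideal J.
  split; first by exists (fun=> 0); rewrite big1 // => i _; rewrite mul0r.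
  split=> [p q [a ->] [b ->]|p q [a ->]].
    exists (fun i => a i + b i); rewrite -big_split.
    by apply: eq_bigr => i _; rewrite mulrDl.
  exists (fun i => p * a i); rewrite big_distrr.
  by apply: eq_bigr => i _; rewrite /= mulrA.
rewrite /in_irrel => f0; rewrite -/(J f) [f]mpolyE big_seq.
apply: ideal_sum => // m; rewrite mcoeff_msupp => fm.
rewrite -mul_mpolyC; apply: idealM => //.
have [i mi] : exists i, m i != 0%N.
  apply/existsP; apply: contraR fm; rewrite negb_exists => /forallP m0.
  suff ->: m = 0%MM by rewrite f0.
  by apply/mnmP=> i; rewrite mnm0E; apply/eqP/negPn.
exists (fun j => if j == i then 'X_[m - U_(i)] else 0).
rewrite (bigD1 i) //= eqxx big1 ?addr0 => [|j /negPf->]; last by rewrite mul0r.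
rewrite -mpolyXD submK //; apply/mnm_lepP=> j.
by rewrite mnm1E; case: eqP => // <-; rewrite lt0n.
Qed.

(* Sections of [A / J] on the punctured spectrum extend: the Koszul form of
   [depth >= 2]. *)
Lemma regseq2_lift gs (u : 'I_n -> A) :
    has_regseq gs 2 -> (forall i j, in_ideal gs ('X_i * u j - 'X_j * u i)) ->
  exists t, forall i, in_ideal gs (u i - 'X_i * t).
Proof.
case/has_regseq2P=> f [g [/in_irrelP[a fa] /in_irrelP[b gb] [reg1 reg2] _]] Ju.
have idJ := in_ideal_is_ideal gs; set J := in_ideal gs in idJ reg1 reg2 Ju *.
have Jlin (c : 'I_n -> A) j :
    J ('X_j * (\sum_i c i * u i) - (\sum_i c i * 'X_i) * u j).
  rewrite big_distrr big_distrl -sumrB; apply: ideal_sum => // i _ /=.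
  have ->: 'X_j * (c i * u i) - c i * 'X_i * u j = c i * ('X_j * u i - 'X_i * u j) by ring.
  exact: idealM.
pose uf := \sum_i a i * u i; pose ug := \sum_i b i * u i.
have Jf j : J ('X_j * uf - f * u j) by rewrite fa; apply: Jlin.
have Jg j : J ('X_j * ug - g * u j) by rewrite gb; apply: Jlin.
(* Modulo [J], [g * uf] equals [f * ug], so regularity of [g] modulo [f] makes [uf] a multiple of
   [f]; the cofactor is the section sought. *)
have [t Jt] : exists t, J (uf - f * t).
  apply: (reg2 uf ug).
  have ->: g * uf - f * ug = \sum_i b i * ('X_i * uf - f * u i).
    rewrite {1}gb /ug big_distrl big_distrr -sumrB.
    by apply: eq_bigr => i _ /=; ring.
  by apply: ideal_sum => // i _; apply: idealM.
exists t => i; apply: reg1.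
have ->: f * (u i - 'X_i * t) = 'X_i * (uf - f * t) - ('X_i * uf - f * u i) by ring.
by apply: idealB => //; apply: idealM.
Qed.

(* [S] separates the degree complex of [I] at [v] into two nonempty parts. *)
Lemma disconnected_no_regseq2 gs U (v : mon) (S : pred 'I_n) i0 j0 :
    upset U -> (forall p, in_ideal gs p <-> mono U p) ->
    (forall i j, S i -> ~~ S j -> U (v + U_(i) + U_(j))%MM) ->
    S i0 -> ~~ U (v + U_(i0))%MM -> ~~ S j0 -> ~~ U (v + U_(j0))%MM ->
  ~ has_regseq gs 2.
Proof.
move=> upU gsU Usep Si0 Ui0 Sj0 Uj0 reg.
(* The local sections are [x^v x_i] for [i] in [S] and 0 for the other [i]; the separation
   hypothesis makes them compatible. *)
have [|t Jt] := regseq2_lift (u := fun i => (S i)%:R * 'X_[v + U_(i)]) reg.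
  move=> i j; apply/gsU.
  have ->: 'X_i * ((S j)%:R * 'X_[v + U_(j)]) - 'X_j * ((S i)%:R * 'X_[v + U_(i)])
      = ((S j)%:R - (S i)%:R) * 'X_[v + U_(i) + U_(j)] :> A.
    by rewrite !mpolyXD; ring.
  have idU := mono_is_ideal K upU.
  case: (boolP (S i)) (boolP (S j)) => Si [] Sj.
  - by rewrite subrr mul0r; case: idU.
  - by apply: (idealM _ idU); apply/monoX/Usep.
  - by apply: (idealM _ idU); apply/monoX; rewrite -addmA (addmC U_(i)%MM) addmA; apply: Usep.
  - by rewrite subrr mul0r; case: idU.
(* Comparing coefficients at [v + U_(i)], a lift [t] must have coefficient 1 at [v] because of [i0],
   and 0 because of [j0]. *)
have coefE i : ~~ U (v + U_(i))%MM -> (S i)%:R = t@_v.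
  move=> Ui; have /gsU/(_ (v + U_(i))%MM) := Jt i.
  rewrite mcoeffB -mpolyC_nat mcoeffCM mcoeffX eqxx mulr1.
  rewrite [X in ('X_i * t)@_X]addmC mcoeffXM.
  by case: eqP => [/eqP|_ /(_ isT) Ui']; [rewrite subr_eq0 => /eqP|rewrite Ui' in Ui].
have := oner_neq0 K; rewrite -[1]/(true%:R) -[true]Si0 (coefE _ Ui0) -(coefE _ Uj0).
by rewrite (negPf Sj0) eqxx.
Qed.

(* The hypotheses present [A / J] as an extension of [A / J2] by [A / J1],
   where [J1 = J : x] and [J2 = J + (x)]. *)
Lemma weakly_regular2_extension J J1 J2 x f g :
    is_ideal J -> is_ideal J2 -> (forall h, J h -> J2 h) -> J2 x ->
    (forall h, J2 h -> exists q, J (h - x * q)) ->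
    (forall q, J (x * q) <-> J1 q) ->
  weakly_regular2 J1 f g -> weakly_regular2 J2 f g -> weakly_regular2 J f g.
Proof.
move=> idJ idJ2 sub J2x J2P J1P [c1 c2] [s1 s2]; split=> [h Jfh|h k Jhk].
  have [q Jq] := J2P h (s1 h (sub _ Jfh)).
  suff Jxq : J (x * q) by rewrite -(subrK (x * q) h); apply: idealD.
  apply/J1P/c1/J1P.
  have ->: x * (f * q) = f * h - f * (h - x * q) by ring.
  by apply: idealB => //; apply: idealM.
have [k1 /J2P[q Jq]] := s2 h k (sub _ Jhk).
(* So [k] agrees with [g * k1] modulo [J2]; the discrepancy [x * k2] turns the relation into one
   between [q] and [k2] modulo [J1]. *)
have /s1/J2P[k2 Jk2] : J2 (f * (k - g * k1)).
  have ->: f * (k - g * k1) = g * q * x + g * (h - f * k1 - x * q)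
     - (g * h - f * k) by ring.
  apply: idealB => //; last exact: sub.
  by apply: idealD => //; apply: idealM => //; apply: sub.
have [q' /J1P Jq'] : exists q', J1 (q - f * q').
  apply: (c2 q k2); apply/J1P.
  have ->: x * (g * q - f * k2) = (g * h - f * k)
     - g * (h - f * k1 - x * q) + f * (k - g * k1 - x * k2) by ring.
  by apply: idealD => //; [apply: idealB => //|]; apply: idealM.
exists (k1 + x * q').
have ->: h - f * (k1 + x * q') = (h - f * k1 - x * q) + x * (q - f * q') by ring.
exact: idealD.
Qed.

(** The extension for a variable: on exponent sets the colon is a shift, and the sum adjoins the
    exponents divisible by the variable. *)
Lemma weakly_regular2_slice U i f g : upset U ->
    weakly_regular2 (mono (fun m => U (U_(i) + m)%MM)) f g ->
    weakly_regular2 (mono (fun m => U m || (0 < m i)%N)) f g ->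
  weakly_regular2 (mono U) f g.
Proof.
move=> upU; apply: (weakly_regular2_extension (x := 'X_i)).
- exact: mono_is_ideal.
- apply: mono_is_ideal => m k /orP[/upU->//|mi].
  by rewrite mnmDE (leq_trans mi) ?orbT // leq_addr.
- by move=> h; apply: mono_sub => m ->.
- by apply/monoX; rewrite mnm1E eqxx orbT.
- exact: mono_addvar.
- by move=> q; apply: mono_colon.
Qed.

Definition linform (phi : 'I_n -> K) : A := \sum_i (phi i)%:MP * 'X_i.

Lemma linform_irrel phi : in_irrel (linform phi).
Proof.
rewrite /in_irrel raddf_sum big1 // => i _ /=.
by rewrite mcoeffCM mcoeffX mnm1_eq0 mulr0.
Qed.

(** [mono (outside d e)] is the prime generated by the variables other than [d] and [e]. Taking
    [d = e] gives the prime of a single vertex. *)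
Definition outside (d e : 'I_n) (m : mon) := [exists i, [&& i != d, i != e & (0 < m i)%N]].

Lemma outside_prime d e : is_prime (mono (outside d e) : A -> Prop).
Proof.
apply: mono_prime => [m k /existsP[i /and3P[id ie mi]]||m k].
- by apply/existsP; exists i; rewrite id ie mnmDE addn_gt0 mi.
- by apply/existsP=> -[i]; rewrite mnm0E !andbF.
case/existsP=> i /and3P[id ie]; rewrite mnmDE addn_gt0 => /orP[] mi; apply/orP.
  by left; apply/existsP; exists i; rewrite id ie.
by right; apply/existsP; exists i; rewrite id ie.
Qed.

(** Modulo this prime the ring is [K[x_d, x_e]], where [x_d] and [x_e] are coprime. *)
Lemma outside_var_coprime d e h k : d != e ->
    mono (outside d e) ('X_e * h - 'X_d * k) ->
  exists q, mono (outside d e) (h - 'X_d * q).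
Proof.
move=> de H; apply: mono_addvar => m hm; rewrite -implyNb; apply/implyP => Um.
rewrite lt0n; apply: contra Um => /eqP md0.
have := H (U_(e) + m)%MM; rewrite mcoeffB mcoeffXM.
have -> : ('X_d * k)@_(U_(e) + m) = 0.
  apply/eqP; apply: contraT => /mcoeffM_neq0[m1 [m2 [+ _ /mnmP/(_ d)]]].
  rewrite mcoeffX; case: (U_(d)%MM =P m1) => [<-|]; last by rewrite eqxx.
  by rewrite !mnmDE !mnm1E eqxx md0 (eq_sym e) (negPf de).
rewrite subr0 => /(_ hm) /existsP[i /and3P[id ie mi]].
apply/existsP; exists i; rewrite id ie; move: mi.
by rewrite mnmDE mnm1E eq_sym (negPf ie).
Qed.

(** In [K[x_d, x_e]] two linear forms with nonzero determinant are a system of parameters; Cramer's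
    rule reduces this to coprimality of the variables. *)
Lemma weakly_regular2_outside d e phi psi : d != e ->
    phi d * psi e - phi e * psi d != 0 ->
  weakly_regular2 (mono (outside d e)) (linform phi) (linform psi).
Proof.
move=> de det; set J := mono _; have [idJ [_ Jp]] := outside_prime d e : is_prime J.
have lin chi : J (linform chi - ((chi d)%:MP * 'X_d + (chi e)%:MP * 'X_e)).
  rewrite /linform (bigD1 d) // (bigD1 e) 1?eq_sym //=.
  rewrite addrA [X in J X]addrAC subrr add0r; apply: ideal_sum => // i /andP[id ie].
  apply: (idealM _ idJ); apply/monoX/existsP; exists i.
  by rewrite id ie mnm1E eqxx.
have notJ : ~ J (linform phi).
  move=> Jphi; have : J ((phi d)%:MP * 'X_d + (phi e)%:MP * 'X_e).
    rewrite -[X in J X](subKr (linform phi)); exact: (idealB idJ _ (lin phi)).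
  have ed : e != d by rewrite eq_sym.
  have out i : i \in [:: d; e] -> ~~ outside d e U_(i)%MM.
    rewrite !inE => die; apply/existsP=> -[j /and3P[jd je]].
    by rewrite mnm1E lt0b => /eqP ij; move: die; rewrite ij (negPf jd) (negPf je).
  move=> H; case/eqP: det.
  have Hi i : i \in [:: d; e] -> phi d * (d == i)%:R + phi e * (e == i)%:R = 0.
    move=> die; apply/eqP; apply: contraR (out i die) => nz; apply: H.
    by rewrite mcoeffD !mcoeffCM !mcoeffXU.
  have := Hi d; have := Hi e; rewrite !inE !eqxx orbT (negPf de) (negPf ed).
  by rewrite !mulr1 !mulr0 add0r addr0 => -> // -> //; ring.
split=> [h /Jp[]//|h k Jhk].
have J1 : J ('X_e * ((psi e)%:MP * h - (phi e)%:MP * k)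
             - 'X_d * ((phi d)%:MP * k - (psi d)%:MP * h)).
  have ->: 'X_e * ((psi e)%:MP * h - (phi e)%:MP * k)
             - 'X_d * ((phi d)%:MP * k - (psi d)%:MP * h) =
    linform psi * h - linform phi * k
     - h * (linform psi - ((psi d)%:MP * 'X_d + (psi e)%:MP * 'X_e))
     + k * (linform phi - ((phi d)%:MP * 'X_d + (phi e)%:MP * 'X_e)) by ring.
  by apply: (idealD idJ) => //; [apply: (idealB idJ) => //|]; apply: (idealM _ idJ) => //.
have [q Jq] := outside_var_coprime de J1.
have Jq' : J ((phi d)%:MP * k - (psi d)%:MP * h - 'X_e * q).
  have : J ('X_d * ((phi d)%:MP * k - (psi d)%:MP * h - 'X_e * q)).
    set l := _ - _ * h in J1 *; set r := _ - _ * k in Jq J1.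
    have ->: 'X_d * (l - 'X_e * q) = 'X_e * (r - 'X_d * q) - ('X_e * r - 'X_d * l) by ring.
    by apply: (idealB idJ) => //; apply: (idealM _ idJ) => //.
  case/Jp=> // /monoX /existsP[i /and3P[id _]].
  by rewrite mnm1E eq_sym (negPf id).
(* Eliminating [k] from [Jq] and [Jq'] gives [det' * h = linform phi * q] modulo [J]. *)
exists ((phi d * psi e - phi e * psi d)^-1%:MP * q).
set det' := phi d * _ - _ in det *.
have -> : h - linform phi * (det'^-1%:MP * q) =
   det'^-1%:MP * (det'%:MP * h - linform phi * q).
  have detV : det'^-1%:MP * det'%:MP = 1 :> A by rewrite -mpolyCM mulVf.
  by rewrite mulrBr [X in _ = X - _]mulrA detV; ring.
apply: (idealM _ idJ) => //.
have ->: det'%:MP * h - linform phi * q =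
   (phi d)%:MP * ((psi e)%:MP * h - (phi e)%:MP * k - 'X_d * q) +
   (phi e)%:MP * ((phi d)%:MP * k - (psi d)%:MP * h - 'X_e * q) -
   q * (linform phi - ((phi d)%:MP * 'X_d + (phi e)%:MP * 'X_e)).
  by rewrite /det' mpolyCB !mpolyCM; ring.
by apply: (idealB idJ) => //; [apply: (idealD idJ) => //|]; apply: (idealM _ idJ) => //.
Qed.

End Depth.

Local Open Scope nat_scope.

(** * Orientations of the 5-cycle *)

(** Vertices are positions 0 to 4 on the cycle, and bit [i] of [o] orients the edge from [i] to its
    successor. Below, [h] marks the vertices of weight greater than 1. *)
Definition cyc_arcs (o : seq bool) : seq (nat * nat) :=
  [seq if nth true o i then (i, i.+1 %% 5) else (i.+1 %% 5, i) | i <- iota 0 5].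

Definition no_heavy_source (o h : seq bool) :=
  all (fun k => nth false h k ==> has (fun e => e.2 == k) (cyc_arcs o)) (iota 0 5).

Definition adj5 i j := (j == i.+1 %% 5) || (i == j.+1 %% 5).

(** The dihedral group of order 10, each element given as its list of images. *)
Definition c5_auts : seq (seq nat) := [seq p <- permutations (iota 0 5) |
  all (fun i => all (fun j => adj5 (nth 0 p i) (nth 0 p j) == adj5 i j)
    (iota 0 5)) (iota 0 5)].

Definition has_type (es : seq (nat * nat)) (light heavy : seq nat) (o h : seq bool) :=
  has (fun p => [&& all (fun e => (nth 0 p e.1, nth 0 p e.2) \in cyc_arcs o) es,
    all (fun k => ~~ nth false h (nth 0 p k)) light &
    all (fun k => nth false h (nth 0 p k)) heavy]) c5_auts.

(** Indices start at 0: [x1] is 0, [x2] is 1, and so on. Edges of free orientation are not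
    listed. *)
Definition has_D1 := has_type [:: (3, 2); (3, 4); (2, 1); (4, 0)] [:: 0; 1; 3] [:: 2; 4].
Definition has_D2 := has_type [:: (3, 2); (4, 3); (0, 4)] [:: 0; 1; 2] [:: 3; 4].
Definition has_D3 := has_type [:: (3, 2); (4, 3); (0, 4)] [:: 0; 1] [:: 2; 3; 4].
Definition has_D4 := has_type [:: (3, 2); (3, 4); (1, 2); (0, 1)] [:: 0; 3] [:: 1; 2; 4].

Definition cm_shape (o h : seq bool) := has_D4 o h ||
  [&& has (fun e => ~~ nth false h e.1 && ~~ nth false h e.2) (cyc_arcs o),
      ~~ has_D1 o h, ~~ has_D2 o h & ~~ has_D3 o h].

(* A partial slicing is a list of codes, one per variable: exponent 0 (code 0),
   between 1 and w - 1 (code 1), at least w (code 2), undecided (code 3).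
   Variables of code 0 or 1 are killed, those of code 2 remain free. *)
Definition code_in (o : seq bool) (c : seq nat) :=
  has (fun e => (0 < nth 0 c e.1) && (nth 0 c e.2 == 2)) (cyc_arcs o).

(** An undecided variable has shift 0 but stays free: it counts as 0 when asking whether the shift
    is already in the ideal, and as 2 when asking which variables survive. *)
Definition fill t (c : seq nat) := [seq if k == 3 then t else k | k <- c].

(** The sets [{k, k + 2}] are the maximal independent sets of the cycle, the complements of its
    minimal vertex covers. *)
Definition code_face (c : seq nat) := has (fun k =>
  all (fun i => (nth 0 c i == 2) == (i \in [:: k; (k + 2) %% 5])) (iota 0 5)) (iota 0 5).

(* [||] and [&&] are strict under call-by-value reduction, hence the
   conditionals here and in [slicing]. *)
Fixpoint exists_in (T : Type) (a : T -> bool) s :=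
  if s is x :: s' then if a x then true else exists_in a s' else false.

Fixpoint forall_in (T : Type) (a : T -> bool) s :=
  if s is x :: s' then if a x then forall_in a s' else false else true.

(** Searches for a slicing tree whose leaves are the unit ideal or the prime of a face. Code 1 is
    offered only at heavy vertices, since weight 1 leaves no exponent there. Five decisions and a
    leaf test take 6 units of fuel. *)
Fixpoint slicing (fuel : nat) (o h : seq bool) (c : seq nat) : bool :=
  if fuel is fuel'.+1 then
    if code_in o (fill 0 c) then true else
    if code_face (fill 2 c) then ~~ code_in o (fill 2 c) else
    exists_in (fun j => if nth 0 c j == 3 then
      forall_in (fun t => slicing fuel' o h (set_nth 0 c j t))
         (if nth false h j then [:: 0; 2; 1] else [:: 0; 2]) else false) (iota 0 5)
  else false.

(* Is the product of the monomial with exponent 0 at [a] and w - 1 elsewhere by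
   the variables of [inc] in the edge ideal? *)
Definition sep_in (o h : seq bool) a (inc : seq nat) := has (fun e =>
  ((e.1 \in inc) || (e.1 != a) && nth false h e.1) &&
  ((e.2 \in inc) && ~~ ((e.2 == a) && nth false h e.2))) (cyc_arcs o).

(** These are the hypotheses of [disconnected_no_regseq2] for the part [{a, b}]. *)
Definition separated (o h : seq bool) a b :=
  let S := [:: a; b] in let S' := [seq k <- iota 0 5 | k \notin S] in
  [&& all (fun i => all (fun j => sep_in o h a [:: i; j]) S') S,
      has (fun i => ~~ sep_in o h a [:: i]) S & has (fun j => ~~ sep_in o h a [:: j]) S'].

Fixpoint bitlists n : seq (seq bool) :=
  if n is n'.+1 then [seq b :: s | b <- [:: true; false], s <- bitlists n'] else [:: [::]].

Lemma mem_bitlists s : s \in bitlists (size s).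
Proof.
elim: s => [//|b s IH]; by rewrite /= cats0 mem_cat; case: b; rewrite map_f ?orbT.
Qed.

(** Among the 32 orientations and 32 weight patterns, every pair without a heavy source receives a
    certificate: a slicing tree or two nonadjacent separating vertices, as [cm_shape] dictates. *)
Lemma shape_cases : all (fun o => all (fun h =>
  if no_heavy_source o h then
    if cm_shape o h then slicing 6 o h (nseq 5 3)
    else has (fun a => has (separated o h a) [:: (a + 2) %% 5; (a + 3) %% 5]) (iota 0 5)
  else true) (bitlists 5)) (bitlists 5).
Proof. by vm_compute. Qed.

(** * Edge ideals *)

Section EdgeIdeal.
Variables (K : fieldType) (n : nat) (arc : rel 'I_n) (w : 'I_n -> nat).

(** Exponents are plain functions, so that a shift plus a monomial can be inserted. *)
Definition edge_mon (m : 'I_n -> nat) :=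
  [exists x, exists y, [&& arc x y, 0 < m x & w y <= m y]].

Lemma edge_monP m :
  reflect (exists x y, [/\ arc x y, 0 < m x & w y <= m y]) (edge_mon m).
Proof.
apply: (iffP existsP) => [[x /existsP[y /and3P[? ? ?]]]|[x [y [? ? ?]]]].
  by exists x, y.
by exists x; apply/existsP; exists y; apply/and3P.
Qed.

Lemma edge_mon_le m m' : (forall x, m x <= m' x) -> edge_mon m -> edge_mon m'.
Proof.
move=> mm' /edge_monP[x [y [xy mx my]]]; apply/edge_monP; exists x, y.
by split=> //; [apply: leq_trans mx _|apply: leq_trans my _].
Qed.

Lemma edge_mon_upset : upset (fun m : 'X_{1..n} => edge_mon m).
Proof. by move=> m k; apply: edge_mon_le => x; rewrite mnmDE leq_addr. Qed.

(** Without loops the two factors of a generator involve different variables, so divisibility by it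
    amounts to the two separate bounds of [edge_mon]. *)
Lemma in_edge_ideal p : (forall x, ~~ arc x x) ->
  in_ideal (edge_gens K arc w) p <-> mono (fun m : 'X_{1..n} => edge_mon m) p.
Proof.
move=> irr; split.
  apply: in_ideal_min; first exact/mono_is_ideal/edge_mon_upset.
  move=> g /mapP[[x y]]; rewrite mem_enum inE /= => xy ->.
  rewrite mpolyXn -mpolyXD; apply/monoX/edge_monP; exists x, y.
  split=> //; rewrite mnmDE mulmnE !mnm1E eqxx ?mul1n //.
  exact: leq_addl.
move=> Hp; rewrite [p]mpolyE big_seq.
have idg := in_ideal_is_ideal (edge_gens K arc w).
apply: ideal_sum => // m; rewrite mcoeff_msupp => /Hp/edge_monP[x [y [xy mx my]]].
rewrite -mul_mpolyC; apply: (idealM _ idg).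
have le : (U_(x) + U_(y) *+ w y <= m)%MM.
  apply/mnm_lepP=> z; rewrite mnmDE mulmnE !mnm1E.
  case: (eqVneq x z) => [<-|xz]; case: (eqVneq y _) => [yz|_];
    rewrite ?mul1n ?mul0n ?add0n ?addn0 //.
    by have := irr x; rewrite -{2}yz xy.
  by rewrite -yz.
rewrite -(submK le) mpolyXD; apply: (idealM _ idg).
rewrite mpolyXD -mpolyXn; apply: mem_in_ideal; apply/mapP.
by exists (x, y) => //; rewrite mem_enum.
Qed.

End EdgeIdeal.

(** * Weighted oriented 5-cycles: slicing and separation *)

Section FiveCycle.
Variables (K : fieldType) (arc : rel 'I_5) (w : 'I_5 -> nat) (s : {perm 'I_5}).
Variables (o h : seq bool).
Hypothesis wog : is_wog arc w.
Hypothesis cyc : forall x y, (arc x y || arc y x) = cyc5 (s x) (s y).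
Hypothesis arcE : forall x y, arc x y = ((val (s x), val (s y)) \in cyc_arcs o).
Hypothesis heavyE : forall x, (w x != 1) = nth false h (s x).
Local Notation A := {mpoly K[5]}.

Let v (k : nat) : 'I_5 := (s^-1)%g (inord k).

Let sv k : k < 5 -> val (s (v k)) = k.
Proof. by move=> k5; rewrite /v permKV /= inordK. Qed.

Let w_gt0 x : 0 < w x. Proof. by case: wog => _ [_ []]. Qed.

Let has_arcP (P : pred (nat * nat)) :
  reflect (exists x y, arc x y /\ P (val (s x), val (s y))) (has P (cyc_arcs o)).
Proof.
apply: (iffP hasP) => [[[a b] ab Pab]|[x [y [xy Pxy]]]]; last first.
  by exists (val (s x), val (s y)); rewrite -?arcE.
have [a5 b5] : a < 5 /\ b < 5.
  move: ab => /mapP[i]; rewrite mem_iota => /= i5.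
  by case: ifP => _ [-> ->]; rewrite ltn_pmod.
by exists (v a), (v b); rewrite arcE !sv.
Qed.

(** What code [k] means for one variable: [W] is its weight, [t] its exponent in the shift, and
    [killed] tells whether it has been adjoined to the ideal. *)
Definition code_ok k W t (killed : bool) :=
  match k with
  | 0 => (t == 0) && killed
  | 1 => (0 < t < W) && killed
  | 2 => (t == W) && ~~ killed
  | 3 => (t == 0) && ~~ killed
  | _ => false
  end.

(** The exponent set of [(I : x^sh) + (x_i : i in L)], where [I] is the edge ideal. *)
Definition residual (sh : 'I_5 -> nat) (L : pred 'I_5) (m : 'X_{1..5}) :=
  [exists x, L x && (0 < m x)] || edge_mon arc w (fun x => sh x + m x).

Lemma residual_upset sh L : upset (residual sh L).
Proof.
move=> m k /orP[/existsP[x /andP[Lx mx]]|e]; apply/orP; [left|right].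
  by apply/existsP; exists x; rewrite Lx mnmDE addn_gt0 mx.
by apply: edge_mon_le e => x; rewrite mnmDE addnA leq_addr.
Qed.

(** The shift monomial itself already lies in the edge ideal. *)
Lemma code_in_full c sh L : size c = 5 ->
    (forall x, code_ok (nth 0 c (s x)) (w x) (sh x) (L x)) ->
  code_in o (fill 0 c) -> forall m, residual sh L m.
Proof.
move=> sz ok /has_arcP[x [y [xy /= /andP[cx cy]]]] m; apply/orP; right.
apply/edge_monP; exists x, y; split=> //; apply: leq_trans (leq_addr _ _).
  move: (ok x) (w_gt0 x) cx; rewrite (nth_map 0) ?sz //.
  by case: (nth 0 c _) => [|[|[|[|]]]] //= /andP[]; [case/andP|move/eqP->].
move: (ok y) cy; rewrite (nth_map 0) ?sz //.
by case: (nth 0 c _) => [|[|[|[|]]]] //= /andP[/eqP->].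
Qed.

(** An edge monomial using no killed variable would come from an arc with tail of nonzero code and
    free head, which the failure of [code_in] excludes. *)
Lemma code_face_outside c sh L k : size c = 5 -> k < 5 ->
    (forall x, code_ok (nth 0 c (s x)) (w x) (sh x) (L x)) ->
    (forall i, i < 5 -> (nth 0 (fill 2 c) i == 2) = (i \in [:: k; (k + 2) %% 5])) ->
    ~~ code_in o (fill 2 c) ->
  residual sh L =1 outside (v k) (v ((k + 2) %% 5)).
Proof.
move=> sz k5 ok face nin m.
have topE x : (nth 0 (fill 2 c) (s x) == 2) = ~~ ((x != v k) && (x != v ((k + 2) %% 5))).
  rewrite face // !inE -negb_or negbK.
  by rewrite -{1}(sv k5) -{1}(sv (ltn_pmod (k + 2) (isT : 0 < 5))) !val_eqE !(inj_eq perm_inj).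
have LE x : L x = ~~ (nth 0 (fill 2 c) (s x) == 2).
  move: (ok x); rewrite (nth_map 0) ?sz //.
  by case: (nth 0 c _) => [|[|[|[|]]]] //= /andP[_]; case: (L x).
apply/orP/existsP => [[/existsP[x /andP[Lx mx]]|/edge_monP[x [y [xy mx my]]]]|[x]].
- by exists x; rewrite andbA mx andbT; move: Lx; rewrite LE topE negbK.
- case: (boolP (L x && (0 < m x))) => [/andP[Lx mx']|nx].
    by exists x; rewrite andbA mx' andbT; move: Lx; rewrite LE topE negbK.
  case: (boolP (L y && (0 < m y))) => [/andP[Ly my']|ny].
    by exists y; rewrite andbA my' andbT; move: Ly; rewrite LE topE negbK.
  case/negP: nin; apply/has_arcP; exists x, y; split=> //=.
  apply/andP; split.
    move: (ok x) mx nx; rewrite (nth_map 0) ?sz //.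
    case: (nth 0 c _) => [|[|[|[|]]]] //= /andP[/eqP-> ->].
    by rewrite add0n /= => ->.
  (* A killed head would have no exponent beyond its shift, and that shift is below its weight. *)
  move: (ok y) my ny; rewrite -[_ == 2]negbK -LE => oky my ny.
  apply/negP => Ly; move: ny; rewrite Ly /= -eqn0Ngt => /eqP my0.
  move: my oky (w_gt0 y); rewrite my0 addn0 Ly.
  case: (nth 0 c _) => [|[|[|[|]]]] //= wy; rewrite ?andbF // andbT.
    by move/eqP=> sh0; rewrite sh0 leqNgt in wy; rewrite (negPf wy).
  by rewrite (ltnNge (sh y)) wy andbF.
rewrite andbA => /andP[out mx]; left; apply/existsP; exists x.
by rewrite LE topE negbK out.
Qed.

(* A linear system of parameters on each face [{k, k + 2}] of the cycle. *)
Definition sop1 : A := linform (fun x => (s x <= 2)%:R%R).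
Definition sop2 : A := linform (fun x => (2 <= s x)%:R%R).

(** All five determinants are 1 or -1, hence nonzero in every characteristic. *)
Lemma sop_outside k : k < 5 ->
  weakly_regular2 (mono (outside (v k) (v ((k + 2) %% 5)))) sop1 sop2.
Proof.
move=> k5; have k5' : (k + 2) %% 5 < 5 by rewrite ltn_pmod.
apply: weakly_regular2_outside.
  apply/eqP=> /(congr1 (fun x => val (s x))); rewrite !sv //.
  by case: k k5 {k5'} => [|[|[|[|[|]]]]].
rewrite !sv //; case: k k5 {k5'} => [|[|[|[|[|]]]]] //= _.
all: by rewrite ?mul0r ?mulr0 ?mulr1 ?subr0 ?sub0r ?oppr_eq0 oner_eq0.
Qed.

Lemma exists_inE (T : Type) (a : pred T) r : exists_in a r = has a r.
Proof. by elim: r => //= x r ->; case: (a x). Qed.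

Lemma forall_inE (T : Type) (a : pred T) r : forall_in a r = all a r.
Proof. by elim: r => //= x r ->; case: (a x). Qed.

Lemma slicing_sound fuel c sh L : size c = 5 ->
    (forall x, code_ok (nth 0 c (s x)) (w x) (sh x) (L x)) ->
  slicing fuel o h c -> weakly_regular2 (mono (residual sh L)) sop1 sop2.
Proof.
elim: fuel => [//|fuel IH] in c sh L *; move=> sz ok; rewrite /slicing -/slicing.
case: ifP => [full _|_].
  split=> [p _ m _|p q _]; first exact: code_in_full ok full m.
  by exists 0%R => m _; apply: code_in_full ok full m.
case: ifP => [/hasP[k + /allP face] nin|_].
  rewrite mem_iota => k5.
  have := sop_outside k5; apply: weakly_regular2_ext => p; apply: mono_ext => m.
  rewrite (code_face_outside (c := c) (k := k)) // => i i5.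
  by rewrite (eqP (face i _)) // mem_iota.
rewrite exists_inE => /hasP[j]; rewrite mem_iota => /= j5.
case: ifP => // /eqP cj; rewrite forall_inE => /allP slices.
pose x := v j; have sx : val (s x) = j by rewrite sv.
have := ok x; rewrite sx cj => /andP[/eqP shx Lx].
pose sh' t y := if y == x then t else sh y.
pose L' y := (y == x) || L y.
have slice t l : t \in (if nth false h j then [:: 0; 2; 1] else [:: 0; 2]) ->
    code_ok t (w x) l (t != 2) ->
    weakly_regular2 (mono (residual (sh' l) (if t == 2 then L else L'))) sop1 sop2.
  move=> tin okt; apply: (IH (set_nth 0 c j t)) => [|y|].
  - by rewrite size_set_nth sz; apply/maxn_idPr.
  - rewrite nth_set_nth /= /sh' -sx (inj_eq val_inj) (inj_eq perm_inj).
    case: (eqVneq y x) => [->|yx].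
      by move: okt; case: (t == 2) => /=; rewrite /L' ?eqxx ?(negPf Lx).
    by move: (ok y); case: (t == 2) => /=; rewrite /L' ?(negPf yx).
  - exact: slices.
(* Descent on the shift of [x] from [w x] to 0. Shift [w x] is the slice of code 2. Lowering it by
   one is an extension whose colon part is the previous case and whose sum part is a slice of code
   1, or of code 0 at shift 0. *)
suff H l : l <= w x -> weakly_regular2 (mono (residual (sh' (w x - l)) L)) sop1 sop2.
  have := H _ (leqnn _); rewrite subnn; apply: weakly_regular2_ext => p.
  apply: mono_ext => m; rewrite /residual; congr (_ || _).
  apply: eq_existsb => y; apply: eq_existsb => z.
  by rewrite /sh'; case: (eqVneq y x) => [->|]; case: (eqVneq z x) => [->|]; rewrite ?shx.
elim: l => [_|l IHl lw].
  rewrite subn0; apply: (slice 2); first by case: ifP.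
  by rewrite /= eqxx.
apply: (weakly_regular2_slice (i := x)); first exact: residual_upset.
  apply: weakly_regular2_ext (IHl (ltnW lw)) => p; apply: mono_ext => m.
  rewrite /residual; congr (_ || _).
    apply: eq_existsb => y; rewrite mnmDE mnm1E.
    by case: (eqVneq x y) => [<-|]; rewrite ?(negPf Lx).
  apply: eq_existsb => y; apply: eq_existsb => z; rewrite !mnmDE !mnm1E /sh'.
  have shE u : (if u == x then w x - l else sh u) + m u =
     (if u == x then w x - l.+1 else sh u) + ((x == u) + m u).
    by rewrite eq_sym; case: eqP => // <-; rewrite addnA addn1 subnSK.
  by rewrite !shE.
suff: weakly_regular2 (mono (residual (sh' (w x - l.+1)) L')) sop1 sop2.
  apply: weakly_regular2_ext => p; apply: mono_ext => m.
  rewrite /residual orbAC; congr (_ || _).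
  apply/existsP/orP => [[y /andP[/orP[/eqP->|Ly] my]]|[/existsP[y /andP[Ly my]]|mx]].
  - by right.
  - by left; apply/existsP; exists y; rewrite Ly.
  - by exists y; rewrite /L' Ly orbT.
  - by exists x; rewrite /L' eqxx.
case: (posnP (w x - l.+1)) => [->|gt0].
  by apply: (slice 0); [case: ifP|].
apply: (slice 1); last by rewrite /= gt0 andbT ltn_subrL w_gt0.
(* A shift strictly between 0 and the weight forces [w x] above 1, so code 1 is on the list. *)
by rewrite -sx -heavyE; case: eqP => // w1; rewrite w1 in lw gt0; case: l lw gt0 {IHl}.
Qed.


Lemma irreflexive x : ~~ arc x x. Proof. by case: wog. Qed.

Lemma edge_ideal_irrel p : in_ideal (edge_gens K arc w) p -> in_irrel p.
Proof.
move/(in_edge_ideal w _ irreflexive) => Hp; apply/eqP; apply: contraT => /Hp.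
by case/edge_monP=> x [y [_]]; rewrite mnm0E.
Qed.

Lemma slicing_regseq2 : slicing 6 o h (nseq 5 3) -> has_regseq (edge_gens K arc w) 2.
Proof.
move=> sl; apply/has_regseq2P; exists sop1, sop2.
split; [exact: linform_irrel|exact: linform_irrel| |].
  (* The initial state has shift 0 and no killed variable; its residual ideal is the edge ideal. *)
  have := slicing_sound (c := nseq 5 3) (sh := fun=> 0) (L := pred0) _ _ sl.
  case=> // [x|reg1 reg2]; first by rewrite nth_nseq ltn_ord.
  have E p : mono (residual (fun=> 0) pred0) p <-> in_ideal (edge_gens K arc w) p.
    apply: (iff_trans _ (iff_sym (in_edge_ideal w _ irreflexive))).
    apply: mono_ext => m; rewrite /residual; case: existsP => [[]//|_].
    by apply: eq_existsb => x; apply: eq_existsb => y.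
  by apply: weakly_regular2_ext E _.
have gens0 g : g \in edge_gens K arc w ++ [:: sop1; sop2] -> in_irrel g.
  rewrite mem_cat !inE => /orP[/mem_in_ideal/edge_ideal_irrel//|].
  by case/orP=> /eqP->; apply: linform_irrel.
move/(in_ideal_min (in_irrel_is_ideal K 5) gens0); rewrite /in_irrel mcoeff1 eqxx.
by apply/eqP/oner_neq0.
Qed.

Lemma separated_no_regseq2 a b : a < 5 -> b < 5 -> separated o h a b ->
  ~ has_regseq (edge_gens K arc w) 2.
Proof.
move=> a5 b5 /and3P[/allP sep /hasP[i0 i0S i0N] /hasP[j0 j0S j0N]].
pose m : 'X_{1..5} := [multinom if x == v a then 0 else (w x).-1 | x < 5].
have v_eq k x : k < 5 -> (x == v k) = (val (s x) == k).
  by move=> k5; rewrite -{2}(sv k5) (inj_eq val_inj) (inj_eq perm_inj).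
(* Off [a] the exponent [w x - 1] reaches the weight exactly when incremented, and is positive by
   itself exactly at heavy vertices; at [a] an increment reaches only weight 1. *)
have sepE (inc : 'I_5 -> bool) r : (forall x, (val (s x) \in r) = inc x) ->
    edge_mon arc w (fun x => m x + inc x) = sep_in o h a r.
  move=> incE; apply/edge_monP/has_arcP => -[x [y]].
    case=> xy mx my; exists x, y; split=> //=; move: mx my.
    rewrite !incE -!heavyE !mnmE -!v_eq //.
    case: (x == v a); case: (y == v a); case: (inc x); case: (inc y) => //= wx wy;
      have := w_gt0 x; have := w_gt0 y; lia.
  case=> xy /=; rewrite !incE -!heavyE -!v_eq // => H; exists x, y.
  move: H; rewrite !mnmE.
  case: (x == v a); case: (y == v a); case: (inc x); case: (inc y) => //= H;
      have := w_gt0 x; have := w_gt0 y => wx wy; split=> //; lia.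
pose S x := val (s x) \in [:: a; b].
have S'P x : (val (s x) \in [seq k <- iota 0 5 | k \notin [:: a; b]]) = ~~ S x.
  by rewrite mem_filter mem_iota /= ltn_ord andbT.
have mU x : edge_mon arc w (fun z => (m + U_(x))%MM z) = sep_in o h a [:: val (s x)].
  rewrite -(sepE (fun z => z == x)) => [|z]; last first.
    by rewrite inE (inj_eq val_inj) (inj_eq perm_inj).
  by apply: eq_existsb => y; apply: eq_existsb => z; rewrite !mnmDE !mnm1E !(eq_sym x).
have lt5 k : k \in [:: a; b] -> k < 5 by rewrite !inE => /orP[]/eqP->.
have j05 : j0 < 5 by move: j0S; rewrite mem_filter mem_iota => /andP[].
apply: (disconnected_no_regseq2 (v := m) (S := S) (i0 := v i0) (j0 := v j0)
  (@edge_mon_upset _ arc w)).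
- by move=> p; apply/in_edge_ideal/irreflexive.
- move=> x y Sx Sy; have /allP/(_ (val (s y))) := sep _ Sx.
  rewrite S'P Sy => /(_ isT); rewrite -(sepE (fun z => (z == x) || (z == y))) => [|z].
    by apply: edge_mon_le => z; rewrite !mnmDE !mnm1E -addnA leq_add2l (eq_sym x) (eq_sym y);
      case: (z == x); case: (z == y).
  by rewrite !inE !(inj_eq val_inj) !(inj_eq perm_inj).
- by rewrite /S sv // lt5.
- by rewrite mU sv // lt5.
- by rewrite -S'P sv.
- by rewrite mU sv.
Qed.

(** * The dimension of the quotient *)

Lemma vs x : v (s x) = x.
Proof. by rewrite /v inord_val permK. Qed.

Lemma adjacent_codes x y : arc x y || arc y x = adj5 (val (s x)) (val (s y)).
Proof. exact: cyc. Qed.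

(** Vertices of large exponent form an independent set of the cycle, hence number at most two. The
    total weight is a threshold dominating every single weight. *)
Lemma edge_mon_small (m : 'X_{1..5}) : ~~ edge_mon arc w m ->
  exists x y, forall z, z != x -> z != y -> m z < \sum_x w x.
Proof.
move=> nm; pose big k := \sum_x w x <= m (v k).
have w_le x : w x <= \sum_x w x by rewrite (bigD1 x) //= leq_addr.
have indep x y : arc x y || arc y x -> \sum_x w x <= m x -> \sum_x w x <= m y -> False.
  move=> xy mx my; case/negP: nm; case/orP: xy => xy; apply/edge_monP.
    by exists x, y; split; rewrite ?(leq_trans (w_le _)) //
      (leq_trans (w_gt0 x)) ?(leq_trans (w_le _)).
  by exists y, x; split; rewrite ?(leq_trans (w_le _)) //
      (leq_trans (w_gt0 y)) ?(leq_trans (w_le _)).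
have ind i j : i < 5 -> j < 5 -> adj5 i j -> ~~ (big i && big j).
  move=> i5 j5 ij; apply/negP=> /andP[]; apply: indep.
  by rewrite adjacent_codes !sv.
suff [i [j H]] : exists i j, forall k, k < 5 -> k != i -> k != j -> ~~ big k.
  exists (v i), (v j) => z zi zj; rewrite ltnNge -[z]vs; apply: H => //.
    by apply: contra zi => /eqP <-; rewrite vs.
  by apply: contra zj => /eqP <-; rewrite vs.
have := ind 0 1 isT isT isT; have := ind 1 2 isT isT isT; have := ind 2 3 isT isT isT.
have := ind 3 4 isT isT isT; have := ind 4 0 isT isT isT.
(* The eleven independent sets of the cycle; for a singleton or the empty set the witness repeats a
   vertex. *)
case B0: (big 0); case B1: (big 1); case B2: (big 2); case B3: (big 3);
  case B4: (big 4) => //= _ _ _ _ _;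
  [exists 0, 2|exists 0, 3|exists 0, 0|exists 1, 3|exists 1, 4|exists 1, 1
  |exists 2, 4|exists 2, 2|exists 3, 3|exists 4, 4|exists 0, 0];
  by case=> [|[|[|[|[|]]]]] //= *; rewrite ?B0 ?B1 ?B2 ?B3 ?B4.
Qed.

(** Positions 0 and 2 are nonadjacent, so the prime of this face contains the edge ideal; above it
    lie the prime of position 2 alone and the irrelevant ideal. *)
Lemma edge_ideal_chain2 : has_prime_chain (edge_gens K arc w) 2.
Proof.
pose d := v 0; pose e := v 2.
have de : d != e by apply/eqP=> /(congr1 (fun x => val (s x))); rewrite !sv.
pose P i : A -> Prop := match i with
  | 0 => mono (outside d e) | 1 => mono (outside e e) | _ => @in_irrel K 5 end.
have sub0 p : in_ideal (edge_gens K arc w) p -> P 0 p.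
  move/(in_edge_ideal w _ irreflexive); apply: mono_sub => m /edge_monP[x [y [xy mx my]]].
  have my0 := leq_trans (w_gt0 y) my.
  apply/existsP; case: (boolP ((x != d) && (x != e))) => [xde|nx].
    by exists x; rewrite andbA xde.
  exists y; rewrite my0 andbT -negb_or; apply/negP=> ny.
  have : adj5 (val (s x)) (val (s y)) by rewrite -adjacent_codes xy.
  move: nx ny; rewrite -negb_or negbK.
  by case/orP=> /eqP-> /orP[]/eqP->; rewrite !sv.
have sub1 p : P 0 p -> P 1 p.
  by apply: mono_sub => m /existsP[x /and3P[xd xe mx]]; apply/existsP; exists x; rewrite xe.
have sub2 p : P 1 p -> P 2 p.
  move=> Hp; apply/eqP; apply: contraT => /Hp /existsP[x].
  by rewrite mnm0E !andbF.
exists P; split=> [i i2|[|[|//]] _].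
- split; last first.
    move=> g /mem_in_ideal/sub0 g0; case: i i2 => [|[|[|//]]] _ //; first exact: sub1.
    exact/sub2/sub1.
  by case: i i2 => [|[|[|//]]] _; [exact: outside_prime|exact: outside_prime|exact: in_irrel_prime].
- split=> //; exists 'X_d%R; split.
    by apply/monoX/existsP; exists d; rewrite de mnm1E eqxx.
  by case/monoX/existsP=> x /and3P[xd _]; rewrite mnm1E eq_sym (negPf xd).
- split=> //; exists 'X_e%R; split; first by rewrite /P /in_irrel mcoeffX mnm1_eq0.
  by case/monoX/existsP=> x /and3P[xd _]; rewrite mnm1E eq_sym (negPf xd).
Qed.

Lemma cohen_macaulay_regseq2 :
  cohen_macaulay (edge_gens K arc w) <-> has_regseq (edge_gens K arc w) 2.
Proof.
apply: cohen_macaulay_dim2 edge_mon_small _ edge_ideal_chain2 => p.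
by case: (in_edge_ideal w p irreflexive).
Qed.

(** * From bit lists to the isomorphism types *)

Hypothesis size_o : size o = 5.
Hypothesis size_h : size h = 5.

Lemma no_heavy_source_wog : no_heavy_source o h.
Proof.
apply/allP=> k; rewrite mem_iota => /andP[_ k5]; apply/implyP => hk.
apply: contraLR hk => nsrc; rewrite -(sv k5) -heavyE negbK.
have [_ [_ [_ src]]] := wog; apply/eqP/src => y; apply: contra nsrc => yk.
by apply/has_arcP; exists y, (v k); rewrite /= sv.
Qed.

Lemma cohen_macaulay_shape : cohen_macaulay (edge_gens K arc w) <-> cm_shape o h.
Proof.
apply: (iff_trans cohen_macaulay_regseq2).
have memo : o \in bitlists 5 by rewrite -size_o mem_bitlists.
have memh : h \in bitlists 5 by rewrite -size_h mem_bitlists.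
have /allP/(_ o memo)/allP/(_ h memh) := shape_cases.
rewrite no_heavy_source_wog.
case: ifP => [_ /slicing_regseq2 //|_ /hasP[a + /hasP[b bab sep]]].
rewrite mem_iota => /= a5; split=> // reg; exfalso; apply: separated_no_regseq2 sep reg => //.
by move: bab; rewrite !inE => /orP[]/eqP->; rewrite ltn_pmod.
Qed.

Lemma c5_autsP p : reflect (perm_eq p (iota 0 5) /\ forall i j, i < 5 -> j < 5 ->
    adj5 (nth 0 p i) (nth 0 p j) = adj5 i j) (p \in c5_auts).
Proof.
rewrite mem_filter mem_permutations andbC; apply: (iffP andP) => -[-> H]; split=> //.
  move=> i j i5 j5; apply/eqP; have /allP/(_ i) := H; rewrite mem_iota => /(_ i5).
  by move/allP/(_ j); rewrite mem_iota => /(_ j5).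
apply/allP=> i; rewrite mem_iota => /andP[_ i5]; apply/allP=> j.
by rewrite mem_iota => /andP[_ j5]; apply/eqP/H.
Qed.

(** Common form of the four types, in terms of the lists given to [has_type]. *)
Definition labelled_type (es : seq (nat * nat)) (light heavy : seq nat)
    (arc' : rel 'I_5) (w' : 'I_5 -> nat) :=
  [/\ on_labelled_C5 arc' w', {in es, forall e, arc' (inord e.1) (inord e.2)},
      {in light, forall k, w' (inord k) = 1} & {in heavy, forall k, w' (inord k) <> 1}].

(** An isomorphism onto a labelled cycle, read through [s], is an automorphism of the cycle;
    conversely, an automorphism pulls [arc] and [w] back to a labelled cycle. *)
Lemma has_typeP T es light heavy :
    all (fun e => (e.1 < 5) && (e.2 < 5)) es -> all (gtn 5) (light ++ heavy) ->
    (forall arc' w', T arc' w' <-> labelled_type es light heavy arc' w') ->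
  iso_to_type T arc w <-> has_type es light heavy o h.
Proof.
move=> /allP es5 /allP lh5 TE; split.
  case=> arc' [w' [/TE[[_ cyc'] Ees El Eh] [f [farc fw]]]].
  pose y k : 'I_5 := (f^-1)%g (inord k).
  pose p := [seq val (s (y k)) | k <- iota 0 5].
  have pE k : k < 5 -> nth 0 p k = val (s (y k)).
    by move=> k5; rewrite (nth_map 0) ?size_iota // nth_iota.
  have fy k : f (y k) = inord k by rewrite permKV.
  have arcy i j : arc (y i) (y j) = arc' (inord i) (inord j) by rewrite -farc !fy.
  apply/hasP; exists p.
    apply/c5_autsP; split=> [|i j i5 j5]; last first.
      by rewrite !pE // -adjacent_codes !arcy cyc' /cyc5 !inordK.
    have pU : uniq p.
      rewrite map_inj_in_uniq ?iota_uniq // => i j; rewrite !mem_iota => /andP[_ i5] /andP[_ j5].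
      move/val_inj/perm_inj/perm_inj/(congr1 val).
      by rewrite /= !inordK.
    have sub : {subset p <= iota 0 5}.
      by move=> k /mapP[i _ ->]; rewrite mem_iota ltn_ord.
    have [|_ eqp] := uniq_min_size pU sub; first by rewrite size_map.
    by apply: uniq_perm; rewrite ?iota_uniq.
  apply/and3P; split; apply/allP.
  - by move=> e ees; have /andP[e1 e2] := es5 e ees; rewrite !pE // -arcE arcy Ees.
  - move=> k kl; have k5 : k < 5 by apply: lh5; rewrite mem_cat kl.
    by rewrite pE // -heavyE negbK -fw fy El.
  - move=> k kh; have k5 : k < 5 by apply: lh5; rewrite mem_cat kh orbT.
    by rewrite pE // -heavyE -fw fy; apply/eqP/Eh.
case/hasP=> p /c5_autsP[pperm padj] /and3P[/allP pes /allP pl /allP ph].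
have p5 k : k < 5 -> nth 0 p k < 5.
  move=> k5; have : nth 0 p k \in p by rewrite mem_nth // (perm_size pperm) size_iota.
  by rewrite (perm_mem pperm) mem_iota.
pose y (k : 'I_5) := v (nth 0 p k).
have sy k : val (s (y k)) = nth 0 p k by rewrite sv ?p5.
have y_inj : injective y.
  move=> i j /(congr1 (fun x => val (s x))); rewrite !sy => /eqP.
  rewrite nth_uniq ?(perm_size pperm) ?size_iota ?(perm_uniq pperm) ?iota_uniq //.
  by move/eqP/val_inj.
exists (fun i j => arc (y i) (y j)), (fun i => w (y i)); split; last first.
  exists (perm y_inj)^-1%g; split=> [x z|x].
    by rewrite -!(permE y_inj) !permKV.
  by rewrite -(permE y_inj) permKV.
have [irr [asym [wpos src]]] := wog.
apply/TE; split=> [|e ees|k kl|k kh].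
- split; last by move=> i j; rewrite adjacent_codes !sy padj.
  split=> [i|]; first exact: irr.
  split=> [i j|]; first exact: asym.
  split=> [i|i isrc]; first exact: wpos.
  by apply: src => x; have := isrc ((perm y_inj)^-1%g x); rewrite -(permE y_inj) permKV.
- have /andP[e1 e2] := es5 e ees.
  by rewrite arcE !sy !inordK //; apply: pes.
- have k5 : k < 5 by apply: lh5; rewrite mem_cat kl.
  by apply/eqP; rewrite -[_ == _]negbK heavyE sy inordK // pl.
have k5 : k < 5 by apply: lh5; rewrite mem_cat kh orbT.
by apply/eqP; rewrite heavyE sy inordK // ph.
Qed.

Lemma iso_to_types :
  [/\ iso_to_type typeD1 arc w <-> has_D1 o h, iso_to_type typeD2 arc w <-> has_D2 o h,
      iso_to_type typeD3 arc w <-> has_D3 o h & iso_to_type typeD4 arc w <-> has_D4 o h].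
Proof.
split; apply: has_typeP => // arc' w'; split=> [[lab [es ws]]|[lab Ees El Eh]].
1,3,5,7: by case: es => *; case: ws => *; split=> // k; rewrite !inE; do ?[case/orP]; move/eqP=> ->.
all: split=> //; split; split.
all: by [apply: (Ees (_, _))|apply: El|apply: Eh].
Qed.

Lemma cm_shapeP : cm_shape o h <-> (iso_to_type typeD4 arc w \/
  ((exists x y, [/\ arc x y, w x = 1 & w y = 1]) /\
   ~ iso_to_type typeD1 arc w /\ ~ iso_to_type typeD2 arc w /\
   ~ iso_to_type typeD3 arc w)).
Proof.
have lightP : reflect (exists x y, [/\ arc x y, w x = 1 & w y = 1])
    (has (fun e => ~~ nth false h e.1 && ~~ nth false h e.2) (cyc_arcs o)).
  apply: (iffP (has_arcP _)) => -[x [y]].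
    by rewrite /= -!heavyE !negbK => -[xy /andP[/eqP wx /eqP wy]]; exists x, y.
  by case=> xy wx wy; exists x, y; rewrite /= -!heavyE wx wy.
have [[D1 D1'] [D2 D2'] [D3 D3'] [D4 D4']] := iso_to_types; rewrite /cm_shape; split.
  case/orP=> [/D4'|/and4P[/lightP light n1 n2 n3]]; [by left|right; split=> //].
  by split; [|split]; [move/D1|move/D2|move/D3]; apply/negP.
case=> [/D4->//|[/lightP light [n1 [n2 n3]]]]; apply/orP; right; rewrite light.
by apply/and4P; split=> //; apply/negP; [move/D1'|move/D2'|move/D3'].
Qed.

End FiveCycle.

Theorem theorem4p5 (K : fieldType) (arc : rel 'I_5) (w : 'I_5 -> nat) :
  is_wog arc w -> underlying_C5 arc ->
  (cohen_macaulay (edge_gens K arc w) <->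
   (iso_to_type typeD4 arc w \/
    ((exists x y, [/\ arc x y, w x = 1%N & w y = 1%N]) /\
     ~ iso_to_type typeD1 arc w /\ ~ iso_to_type typeD2 arc w /\
     ~ iso_to_type typeD3 arc w))).
Proof.
move=> wog [s cyc].
pose v k : 'I_5 := (s^-1)%g (inord k).
(* The bits are read along the cycle: entry [i] tells whether the edge at position [i] points
   forward. *)
pose o := [seq arc (v i) (v (i.+1 %% 5)) | i <- iota 0 5].
pose h := [seq w (v i) != 1 | i <- iota 0 5].
have vs x : v (s x) = x by rewrite /v inord_val permK.
have sv k : k < 5 -> val (s (v k)) = k by move=> k5; rewrite permKV /= inordK.
have oE i : i < 5 -> nth true o i = arc (v i) (v (i.+1 %% 5)).
  by move=> i5; rewrite (nth_map 0) ?size_iota // nth_iota.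
have heavyE x : (w x != 1) = nth false h (s x).
  by rewrite (nth_map 0) ?size_iota // nth_iota // vs.
have [_ [asym _]] := wog.
have arcE x y : arc x y = ((val (s x), val (s y)) \in cyc_arcs o).
  apply/idP/mapP => [xy|[i]].
    have : cyc5 (s x) (s y) by rewrite -cyc xy.
    case/orP=> /eqP sxy.
      by exists (val (s x)); rewrite ?mem_iota ?ltn_ord // oE ?ltn_ord // -sxy !vs xy.
    exists (val (s y)); rewrite ?mem_iota ?ltn_ord // oE ?ltn_ord // -sxy !vs.
    by rewrite (negPf (asym _ _ xy)).
  rewrite mem_iota => /andP[_ i5]; have i5' : i.+1 %% 5 < 5 by rewrite ltn_pmod.
  rewrite oE //; case: ifP => a [sx sy]; first by rewrite -(vs x) -(vs y) sx sy.
  have : arc (v i) (v (i.+1 %% 5)) || arc (v (i.+1 %% 5)) (v i).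
    by rewrite cyc /cyc5 !sv // eqxx.
  by rewrite a /= -(vs x) -(vs y) sx sy.
apply: (iff_trans (cohen_macaulay_shape K wog cyc arcE heavyE _ _)); rewrite ?size_map //.
exact: cm_shapeP wog cyc arcE heavyE.
Qed.
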